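(* The coordinates $y_D,y_E,y_F$ are algebraic, with minimal polynomials $P_{y_D}=-2470693585135788 + 1679453964496051893 y^2 - 2462573171102886288 y^4 + 1847147913929328048 y^6 - 888334179987132288 y^8 + 302241307009227264 y^{10} - 74768143621533696 y^{12} + 13516084620361728 y^{14} - 1721332250836992 y^{16} + 139442448236544 y^{18} - 6126808596480 y^{20} + 109337116672 y^{22}$, $P_{y_E}=-387038865725307 + 255845547796716 y^2 - 1080696123714384 y^4 + 985178573370432 y^6 + 290816529555456 y^8 + 1229422640467968 y^{10} - 399291497201664 y^{12} - 226953868935168 y^{14} - 145914316455936 y^{16} + 84049703993344 y^{18} - 9462031056896 y^{20} + 437348466688 y^{22}$, $P_{y_F}=-6156736033068 + 4132620043369020 y^2 - 28069535202466347 y^4 + 54174190167055116 y^6 - 44321252355544320 y^8 + 16893977313239424 y^{10} - 3430375146685440 y^{12} + 781964817629184 y^{14} - 165954075623424 y^{16} + 16400930701312 y^{18} - 579898179584 y^{20} + 27334279168 y^{22}$ respectively (i.e. $P_{y_D}(y_D)=P_{y_E}(y_E)=P_{y_F}(y_F)=0$ and each of these polynomials is irreducible over $\mathbb Q$).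
   Context: Consider real numbers $t,T$ and points $A=(0,0)$, $B=(t,T)$, $C=(2t,0)$ and $P=(x_P,y_P)$ for $P\in\{D,E,F,G,H,J\}$ satisfying the system $t^2+T^2=1$; $-t(x_D-2t)+T y_D=\tfrac32$; $(x_D-2t)^2+y_D^2=9$; $t(x_E-t)-T(y_E-T)+1=0$; $(x_E-t)^2+(y_E-T)^2=4$; $x_F^2+y_F^2=1$; $|E-F|^2=1$; $|F-G|^2=1$; $|D-G|^2=4$; $|D-H|^2=4$; $|G-H|^2=4$; $|F-J|^2=1$; $|G-J|^2=1$; $x_H=x_J$. Fix the real solution with $t\approx0.992685948824186$, $T\approx0.120725337054926$, $D\approx(0.809996600722107,\,2.760161754567202)$, $E\approx(0.209102417540010,\,1.960833173433061)$, $F\approx(-0.061398137844065,\,0.998113354619244)$, $G\approx(-0.838419516770942,\,1.627587561152422)$, $H\approx(-0.995049481192288,\,3.621444891616507)$, $J\approx(-0.995049481192288,\,0.639930204451542)$. These points are the essential vertices of one quarter of the Harborth graph (a 4-regular planar unit-distance graph). *)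

(* Defs.v *)
From Stdlib Require Import ZArith.
From mathcomp Require Import all_boot all_order all_algebra.
From mathcomp Require Import reals ssrZ.

Set Implicit Arguments.
Unset Strict Implicit.
Unset Printing Implicit Defensive.

Import Order.TTheory GRing.Theory Num.Theory.
Local Open Scope ring_scope.

(* The image of a binary integer in a ring. Numerals of ring_scope and of
   int_scope are parsed as unary naturals, which rules out the 19-digit
   constants needed here. *)
Definition Zr {R : pzRingType} (z : Z) : R := (int_of_Z z)%:~R.

Definition sqdist (R : pzRingType) (P Q : R * R) : R :=
  (P.1 - Q.1) ^+ 2 + (P.2 - Q.2) ^+ 2.

(* The vertices A = (0, 0), B = (t, T) and C = (2t, 0) are substituted in the
   equations. *)
Definition harborth_system (R : realType) (t T : R) (D E F G H J : R * R)
    : Prop :=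
  [/\ t ^+ 2 + T ^+ 2 = 1,
      - t * (D.1 - 2%:R * t) + T * D.2 = 3%:R / 2%:R
    & (D.1 - 2%:R * t) ^+ 2 + D.2 ^+ 2 = 9%:R] /\
  [/\ t * (E.1 - t) - T * (E.2 - T) + 1 = 0,
      (E.1 - t) ^+ 2 + (E.2 - T) ^+ 2 = 4%:R,
      F.1 ^+ 2 + F.2 ^+ 2 = 1
    & sqdist E F = 1] /\
  [/\ sqdist F G = 1,
      sqdist D G = 4%:R,
      sqdist D H = 4%:R
    & sqdist G H = 4%:R] /\
  [/\ sqdist F J = 1,
      sqdist G J = 1
    & H.1 = J.1].

(* The decimal m * 10^(-15) approximates x to within one unit in its last
   place. *)
Definition approx15 (R : realType) (x : R) (m : Z) : Prop :=
  `|x - Zr m / 10%:R ^+ 15| <= 10%:R ^- 15.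

Definition harborth_approx (R : realType) (t T : R) (D E F G H J : R * R)
    : Prop :=
  (approx15 t 992685948824186 /\ approx15 T 120725337054926) /\
  (approx15 D.1 809996600722107 /\ approx15 D.2 2760161754567202) /\
  (approx15 E.1 209102417540010 /\ approx15 E.2 1960833173433061) /\
  (approx15 F.1 (-61398137844065) /\ approx15 F.2 998113354619244) /\
  (approx15 G.1 (-838419516770942) /\ approx15 G.2 1627587561152422) /\
  (approx15 H.1 (-995049481192288) /\ approx15 H.2 3621444891616507) /\
  (approx15 J.1 (-995049481192288) /\ approx15 J.2 639930204451542).

Definition P_yD : {poly rat} :=
    (Zr (-2470693585135788))%:P
  + Zr 1679453964496051893 *: 'X^2
  - Zr 2462573171102886288 *: 'X^4
  + Zr 1847147913929328048 *: 'X^6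
  - Zr 888334179987132288 *: 'X^8
  + Zr 302241307009227264 *: 'X^10
  - Zr 74768143621533696 *: 'X^12
  + Zr 13516084620361728 *: 'X^14
  - Zr 1721332250836992 *: 'X^16
  + Zr 139442448236544 *: 'X^18
  - Zr 6126808596480 *: 'X^20
  + Zr 109337116672 *: 'X^22.

Definition P_yE : {poly rat} :=
    (Zr (-387038865725307))%:P
  + Zr 255845547796716 *: 'X^2
  - Zr 1080696123714384 *: 'X^4
  + Zr 985178573370432 *: 'X^6
  + Zr 290816529555456 *: 'X^8
  + Zr 1229422640467968 *: 'X^10
  - Zr 399291497201664 *: 'X^12
  - Zr 226953868935168 *: 'X^14
  - Zr 145914316455936 *: 'X^16
  + Zr 84049703993344 *: 'X^18
  - Zr 9462031056896 *: 'X^20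
  + Zr 437348466688 *: 'X^22.

Definition P_yF : {poly rat} :=
    (Zr (-6156736033068))%:P
  + Zr 4132620043369020 *: 'X^2
  - Zr 28069535202466347 *: 'X^4
  + Zr 54174190167055116 *: 'X^6
  - Zr 44321252355544320 *: 'X^8
  + Zr 16893977313239424 *: 'X^10
  - Zr 3430375146685440 *: 'X^12
  + Zr 781964817629184 *: 'X^14
  - Zr 165954075623424 *: 'X^16
  + Zr 16400930701312 *: 'X^18
  - Zr 579898179584 *: 'X^20
  + Zr 27334279168 *: 'X^22.

(* P is a minimal polynomial of y over the rationals, up to a constant factor:
   it is irreducible and vanishes at y. *)
Definition has_min_poly (R : realType) (y : R) (P : {poly rat}) : Prop :=
  root (map_poly ratr P) y /\ irreducible_poly P.

(* Main.v *)
Require Import Defs.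
From HB Require Import structures.
From Stdlib Require Import ZArith.
From mathcomp Require Import all_boot all_order all_algebra.
From mathcomp Require Import finfield qpoly qfpoly.
From mathcomp Require Import reals ssrZ zify ring lra.
Import Order.TTheory GRing.Theory Num.Theory.
Set Implicit Arguments.
Unset Strict Implicit.
Unset Printing Implicit Defensive.
Local Open Scope ring_scope.

(* Put [m = t / (sqrt 3 (1 + T))]. Dividing abscissae by [sqrt 3] makes the
   system rational: [D] and [E] are rational functions of [m], and
   [F = E / 2 + sigma E'] with [E'] orthogonal to [E] and [sigma ^ 2] rational
   in [m]. The triangles DGH and FGJ are equilateral, so [x_H = x_J] is a linear
   equation for [y_G]; eliminating [x_G] gives a quartic in the coordinates of
   [D - F], which reduces to [sigma_num(m) + sigma_den(m) sigma = 0].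
   Eliminating [sigma] leaves [minpoly_m], of degree 22, times factors that do
   not vanish since [y_D > 0]; the three polynomials of the theorem vanish modulo
   [minpoly_m]. All three are irreducible modulo 31. *)

(** * Polynomials given by lists of binary integers *)

HB.instance Definition _ (R : pzRingType) :=
  GRing.RMorphism.copy (@Zr R) (@intmul R 1 \o int_of_Z).

(** Coefficients come lowest degree first. The same list is read over the rationals, the reals and a
    prime field, and identities between lists are decided by computation in [Z]. *)
Definition zpoly (R : nzRingType) (s : seq Z) : {poly R} := Poly (map Zr s).

Lemma zpoly_cons (R : nzRingType) c s :
  zpoly R (c :: s) = (Zr c)%:P + 'X * zpoly R s.
Proof. by rewrite /zpoly /= cons_poly_def addrC commr_polyX. Qed.

Lemma zpoly_nil (R : nzRingType) : zpoly R [::] = 0.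
Proof. by []. Qed.

Lemma zpoly_cat (R : nzRingType) s1 s2 :
  zpoly R (s1 ++ s2) = zpoly R s1 + 'X^(size s1) * zpoly R s2.
Proof.
elim: s1 => [|c s1 IH] /=; first by rewrite zpoly_nil add0r expr0 mul1r.
by rewrite !zpoly_cons IH exprS mulrDr mulrA addrA.
Qed.

Lemma map_zpoly (R S : nzRingType) (f : {rmorphism R -> S}) s :
  map_poly f (zpoly R s) = zpoly S s.
Proof.
elim: s => [|c s IH]; first by rewrite !zpoly_nil rmorph0.
by rewrite !zpoly_cons rmorphD rmorphM /= map_polyX map_polyC IH /Zr /= rmorph_int.
Qed.

Fixpoint zadd (s t : seq Z) : seq Z :=
  match s, t with
  | [::], _ => t
  | _, [::] => s
  | a :: s', b :: t' => Z.add a b :: zadd s' t'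
  end.

Definition zscale (c : Z) (s : seq Z) : seq Z := map (Z.mul c) s.

Fixpoint zmul (s t : seq Z) : seq Z :=
  if s is c :: s' then zadd (zscale c t) (Z0 :: zmul s' t) else [::].

Lemma ZrD (R : pzRingType) a b : Zr (Z.add a b) = Zr a + Zr b :> R.
Proof. exact: rmorphD. Qed.

Lemma ZrM (R : pzRingType) a b : Zr (Z.mul a b) = Zr a * Zr b :> R.
Proof. exact: rmorphM. Qed.

Lemma zpoly_add (R : nzRingType) s t :
  zpoly R (zadd s t) = zpoly R s + zpoly R t.
Proof.
elim: s t => [|a s IH] [|b t] /=; rewrite ?zpoly_nil ?add0r ?addr0 //.
by rewrite !zpoly_cons IH ZrD polyCD mulrDr addrACA.
Qed.

Lemma zpoly_scale (R : comNzRingType) c s :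
  zpoly R (zscale c s) = (Zr c)%:P * zpoly R s.
Proof.
elim: s => [|a s IH] /=; first by rewrite zpoly_nil mulr0.
by rewrite !zpoly_cons -/(zscale c s) IH ZrM polyCM; ring.
Qed.

Lemma zpoly_mul (R : comNzRingType) s t :
  zpoly R (zmul s t) = zpoly R s * zpoly R t.
Proof.
elim: s => [|a s IH] /=; first by rewrite zpoly_nil mul0r.
by rewrite zpoly_add zpoly_scale !zpoly_cons IH /Zr /=; ring.
Qed.

Lemma zpoly0 (R : nzRingType) s : all (eq_op^~ 0) s -> zpoly R s = 0.
Proof.
elim: s => [|c s IH] /=; first by rewrite zpoly_nil.
by case/andP => /eqP -> /IH ss; rewrite zpoly_cons ss mulr0 addr0 rmorph0.
Qed.

(** * Irreducibility over the rationals by reduction modulo a prime *)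

(** With [h] the monic associate of [g], the quotient of [F[X]] by [h] is a field with
    [N = #|F| ^ deg g] elements, all of which satisfy [x ^ N = x]; this is applied to the class of
    [X]. *)
Lemma irreducible_dvd_XpX (F : finFieldType) (g : {poly F}) :
  irreducible_poly g -> g %| 'X^(#|F| ^ (size g).-1) - 'X.
Proof.
move=> irr_g; have g0 := irredp_neq0 irr_g.
pose h := (lead_coef g)^-1 *: g.
have lc0 : (lead_coef g)^-1 != 0 by rewrite invr_eq0 lead_coef_eq0.
have hg : h %= g by apply: eqp_scale.
have hI : monic_irreducible_poly h.
  split; last by rewrite monicE lead_coefZ mulVf // lead_coef_eq0.
  split; first by rewrite (eqp_size hg); case: irr_g.
  move=> q q1; rewrite (eqp_dvdr _ hg) => /(irr_g.2 _ q1).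
  by move/eqp_trans; apply; rewrite eqp_sym.
rewrite -(eqp_dvdl _ hg) -(eqp_size hg) -(card_qfpoly hI).
pose K := {poly %/ h with hI}.
have := expf_card (in_qpoly h 'X : K).
set N := #|_|; move=> E.
have : in_qpoly h ('X^N - 'X) == 0.
  rewrite rmorphB rmorphXn subr_eq0; apply/eqP; exact: E.
rewrite -val_eqE /= .
by rewrite -Pdiv.IdomainMonic.modpE ?mk_monicE ?hI.
Qed.

(** A proper factorization has a factor of degree at most [k], hence an irreducible one of some
    degree [d <= k], and the latter divides [X^(#|F|^d) - X]. *)
Lemma irreducible_by_XpX (F : finFieldType) (f : {poly F}) (k : nat) :
    (1 < size f)%N -> ((size f).-1 <= k.*2.+1)%N ->
    (forall g : {poly F}, irreducible_poly g -> g %| f ->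
      ~~ (g %| \prod_(1 <= d < k.+1) ('X^(#|F| ^ d) - 'X))) ->
  irreducible_poly f.
Proof.
move=> sf sfk Hf; have f0 : f != 0 by rewrite -size_poly_gt0 ltnW.
(* Induction on the size: smaller nonconstant factors being excluded already, [g] is irreducible. *)
have no_small (g : {poly F}) : g %| f -> (1 < size g <= k.+1)%N -> False.
  have [n] := ubnP (size g); elim: n g => // n IH g sgn gf /andP[sg1 sgk].
  have g0 : g != 0 by rewrite -size_poly_gt0 ltnW.
  have irr_g : irreducible_poly g.
    split=> // q q1 qg; rewrite -dvdp_size_eqp // eqn_leq dvdp_leq //= leqNgt.
    apply/negP => sq; apply: (IH q); first exact: leq_trans sq sgn.
      exact: dvdp_trans qg gf.
    rewrite (leq_trans (ltnW sq) sgk) andbT ltn_neqAle eq_sym q1 size_poly_gt0.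
    by apply: contraTneq qg => ->; rewrite dvd0p.
  have /negP := Hf g irr_g gf; apply.

  apply: (dvdp_trans (irreducible_dvd_XpX irr_g)).
  rewrite (bigD1_seq (size g).-1) ?iota_uniq //= ?dvdp_mulr //.
  by rewrite mem_index_iota; case: (size g) sg1 sgk => [|[]].
split=> // q q1 qf.
have q0 : q != 0 by apply: contraTneq qf => ->; rewrite dvd0p.
have sq : (1 < size q)%N by rewrite ltn_neqAle eq_sym q1 size_poly_gt0.
have [r fE] : exists r : {poly F}, f = r * q by exists (f %/ q); rewrite divpK.
have r0 : r != 0 by apply: contraNneq f0 => r0; rewrite fE r0 mul0r.
have sfE : ((size f).-1 = (size r).-1 + (size q).-1)%N.
  have r_gt0 : (0 < size r)%N by rewrite size_poly_gt0.
  by rewrite fE size_mul //; move: (size r) (size q) sq r_gt0 => a b; lia.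
have [sr|sr] := leqP (size r) 1.
  rewrite -dvdp_size_eqp // eqn_leq dvdp_leq //=.
  by move: (size f) (size q) (size r) sf sq sr sfE => a b c; lia.
have [skq|skq] := leqP (size q) k.+1; first by case: (no_small q); rewrite ?sq.
have [skr|skr] := leqP (size r) k.+1.
  by case: (no_small r); rewrite ?sr // fE dvdp_mulr.
by move: (size f) (size q) (size r) sfk sfE skq skr => a b c; lia.
Qed.

(** By Gauss's lemma a rational factor comes, up to a constant, from a factorization over the
    integers. As [p] does not divide the leading coefficient, the factors keep their degrees modulo
    [p]. *)
Lemma irreducible_mod_prime (p : nat) (s : seq Z) :
    prime p -> (Zr (last Z0 s) : 'F_p) != 0 -> irreducible_poly (zpoly 'F_p s) ->
  irreducible_poly (zpoly rat s).
Proof.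
move=> pr_p lc irr_s.
have size_s (R : nzRingType) : (Zr (last Z0 s) : R) != 0 ->
    size (zpoly R s) = size s.
  move=> ls; rewrite /zpoly (@PolyK _ 0) ?size_map // -[0]/(Zr Z0) last_map //.
have szF : size (zpoly 'F_p s) = size s by apply: size_s.
have lc' (R : numDomainType) : (Zr (last Z0 s) : R) != 0.
  apply: contraNneq lc; rewrite -[0](rmorph0 (@Zr R)) /Zr => /intr_inj.
  by move/(can_inj int_of_ZK) => ->.
rewrite -(map_zpoly (intr : {rmorphism int -> rat})).
split; first by rewrite map_zpoly size_s ?lc' //; case: irr_s; rewrite szF.
move=> q q1 qs; have [u [a a0 qE] [r sE]] := dvdpP_rat_int qs.
pose uF := map_poly (intr : int -> 'F_p) u.
pose rF := map_poly (intr : int -> 'F_p) r.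
have sEF : zpoly 'F_p s = uF * rF.
  by rewrite -(map_zpoly (intr : {rmorphism int -> 'F_p})) sE rmorphM.
have uF_le : (size uF <= size u)%N by apply: size_poly.
have rF_le : (size rF <= size r)%N by apply: size_poly.
have sF0 : zpoly 'F_p s != 0 by apply: irredp_neq0.
have sZ : size (zpoly int s) = size s by apply: (size_s int (lc' int)).
have uF0 : uF != 0 by apply: contraNneq sF0; rewrite sEF => ->; rewrite mul0r.
have rF0 : rF != 0 by apply: contraNneq sF0; rewrite sEF => ->; rewrite mulr0.
(* Reduction can only lower the two sizes, and their sum is preserved, so both are preserved. *)
have ruF : (size u + size r = size uF + size rF)%N.
  have : size (u * r) = size (uF * rF) by rewrite -sE sZ -sEF szF.
  rewrite !size_mul //; last 2 first.
  - by apply: contraNneq uF0; rewrite /uF => ->; rewrite rmorph0.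
  - by apply: contraNneq rF0; rewrite /rF => ->; rewrite rmorph0.
  move: uF0 rF0; rewrite -!size_poly_gt0.
  by move: (size u) (size r) (size uF) (size rF) uF_le rF_le => b c d e; lia.
have su : size u = size uF.
  by move: (size u) (size r) (size uF) (size rF) uF_le rF_le ruF => b c d e; lia.
have sq : size q = size uF by rewrite qE size_scale // size_rat_int_poly.
rewrite -dvdp_size_eqp // sq size_rat_int_poly sZ -szF dvdp_size_eqp.
  by apply: irr_s; rewrite -?sq // sEF dvdp_mulr.
by rewrite sEF dvdp_mulr.
Qed.

(* One reduction step modulo [p] and the monic polynomial [X^(size t) - t]; on the
   arguments met in [zmulmod] it is a complete reduction. *)
Definition zred (p : Z) (t s : seq Z) : seq Z :=
  map (Z.modulo^~ p) (zadd (take (size t) s) (zmul (drop (size t) s) t)).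

(** Horner's scheme in [s], reducing at each step: when [u] is reduced, the argument of [zred] has
    at most one coefficient in excess. *)
Fixpoint zmulmod (p : Z) (t s u : seq Z) : seq Z :=
  if s is c :: s' then zred p t (zadd (zscale c u) (Z0 :: zmulmod p t s' u))
  else [::].

Fixpoint zpowmod (p : Z) (t s : seq Z) (e : positive) : seq Z :=
  match e with
  | xH => s
  | xO e' => let r := zpowmod p t s e' in zmulmod p t r r
  | xI e' => let r := zpowmod p t s e' in zmulmod p t s (zmulmod p t r r)
  end.

(* The product of the [X^(p^d) - X] for [1 <= d <= k], starting from [h = X]. *)
Fixpoint zXpXmod (p : positive) (t : seq Z) (k : nat) (h : seq Z) : seq Z :=
  if k is k'.+1 then
    let h' := zpowmod (Zpos p) t h p in
    zmulmod (Zpos p) t (zadd h' [:: Z0; Zneg 1]) (zXpXmod p t k' h')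
  else [:: Zpos 1].

(** * Correctness of the arithmetic modulo [p] and [f] *)

Section ModularArithmetic.

Variables (F : fieldType) (p : Z) (f : {poly F}) (t : seq Z).
Hypotheses (p0 : Zr p = 0 :> F) (ft : f %| 'X^(size t) - zpoly F t).

Local Notation "a === b" := (f %| a - b) (at level 70).

Lemma congr_refl a : a === a.
Proof. by rewrite subrr dvdp0. Qed.

Lemma congr_trans b a c : a === b -> b === c -> a === c.
Proof. by move=> ab bc; rewrite -(subrKA b) dvdp_add. Qed.

Lemma congr_add a b a' b' : a === a' -> b === b' -> a + b === a' + b'.
Proof. by move=> aa bb; rewrite opprD addrACA dvdp_add. Qed.

Lemma congr_mul a b a' b' : a === a' -> b === b' -> a * b === a' * b'.
Proof.
move=> aa bb; have -> : a * b - a' * b' = (a - a') * b + a' * (b - b') by ring.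
by apply: dvdp_add; [exact: dvdp_mulr | exact: dvdp_mull].
Qed.

Lemma zpoly_mod s : zpoly F (map (Z.modulo^~ p) s) = zpoly F s.
Proof.
elim: s => // c s IH; rewrite /= !zpoly_cons IH; congr (_%:P + _).
by rewrite {2}(Z_div_mod_eq_full c p) ZrD ZrM p0 mul0r add0r.
Qed.

Lemma zred_congr s : zpoly F (zred p t s) === zpoly F s.
Proof.
rewrite /zred zpoly_mod zpoly_add zpoly_mul -{3}[s](cat_take_drop (size t)).
rewrite zpoly_cat; set a := zpoly F _; set b := zpoly F (drop _ _).
have [st|st] := leqP (size t) (size s).
  rewrite size_takel //.
  have -> : a + b * zpoly F t - (a + 'X^(size t) * b) =
            - b * ('X^(size t) - zpoly F t) by ring.
  exact: dvdp_mull.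
by rewrite /b drop_oversize ?(ltnW st) // zpoly_nil mul0r mulr0 subrr dvdp0.
Qed.

Lemma zmulmod_congr s u : zpoly F (zmulmod p t s u) === zpoly F s * zpoly F u.
Proof.
elim: s => [|c s IH] /=; first by rewrite zpoly_nil mul0r congr_refl.
apply: congr_trans (zred_congr _) _.
rewrite zpoly_add zpoly_scale !zpoly_cons mulrDl.
apply: congr_add; first exact: congr_refl.
by rewrite rmorph0 add0r -mulrA; apply: congr_mul => //; apply: congr_refl.
Qed.

Lemma zpowmod_congr s e : zpoly F (zpowmod p t s e) === zpoly F s ^+ Pos.to_nat e.
Proof.
have sq r k : r === zpoly F s ^+ k -> r * r === zpoly F s ^+ (k + k).
  by move=> rk; rewrite exprD; apply: congr_mul.
elim: e => [e IH|e IH|] /=; last exact: congr_refl.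
- have -> : Pos.to_nat e~1 = (Pos.to_nat e + Pos.to_nat e).+1 by lia.
  apply: congr_trans (zmulmod_congr _ _) _; rewrite exprS.
  apply: congr_mul; first exact: congr_refl.
  apply: congr_trans (zmulmod_congr _ _) _.
  exact: sq.
- have -> : Pos.to_nat e~0 = (Pos.to_nat e + Pos.to_nat e)%N by lia.
  apply: congr_trans (zmulmod_congr _ _) _.
  exact: sq.
Qed.

Lemma congr_exp a b k : a === b -> a ^+ k === b ^+ k.
Proof.
move=> ab; elim: k => [|k IH]; first exact: congr_refl.
by rewrite !exprS; apply: congr_mul.
Qed.

End ModularArithmetic.

Lemma zXpXmod_congr (F : fieldType) (p : positive) (f : {poly F}) t k h H :
    Zr (Zpos p) = 0 :> F -> f %| 'X^(size t) - zpoly F t -> f %| zpoly F h - H ->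
  f %| zpoly F (zXpXmod p t k h)
       - \prod_(1 <= d < k.+1) (H ^+ (Pos.to_nat p ^ d) - 'X).
Proof.
move=> p0 ft; elim: k h H => [|k IH] h H hH.
  by rewrite big_geq // !zpoly_cons zpoly_nil mulr0 addr0 subrr dvdp0.
rewrite [zXpXmod _ _ _ _]/=; set h' := zpowmod _ _ _ _.
have h'H : f %| zpoly F h' - H ^+ Pos.to_nat p.
  apply: congr_trans (zpowmod_congr p0 ft _ _) _.
  exact: congr_exp.
rewrite big_nat_recl //; apply: congr_trans (zmulmod_congr p0 ft _ _) _.
apply: congr_mul.
  rewrite zpoly_add !zpoly_cons zpoly_nil expn1.
  have -> : (Zr Z0)%:P + 'X * ((Zr (Zneg 1))%:P + 'X * 0) = - 'X :> {poly F}.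
    by rewrite mulr0 addr0 rmorph0 add0r (_ : Zr (Zneg 1) = -1) // polyCN mulrN1.
  by rewrite opprB addrA subrK.
apply: congr_trans (IH _ _ h'H) _.
rewrite (eq_bigr (fun i => H ^+ (Pos.to_nat p ^ i.+1) - 'X)).
  exact: congr_refl.
by move=> i _; rewrite -exprM expnS.
Qed.

Definition irreducible_check (p : positive) (c : Z) (v s : seq Z) :=
  let n := (size s).-1 in
  let t := map (fun a => Z.opp (Z.mul c a)) (take n s) in
  let w := zXpXmod p t n./2 [:: Z0; Zpos 1] in
  [&& (0 < n)%N, Z.modulo (Z.mul c (last Z0 s)) (Zpos p) == Zpos 1
    & all (eq_op^~ 0) (zadd (zmulmod (Zpos p) t w v) [:: Zneg 1])].

(* [c] inverts the leading coefficient modulo [p], so that [f] divides [X^n - t],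
   and [v] inverts the product of the [X^(p^d) - X], for [d <= n/2], modulo [f]. *)
Lemma irreducible_checkP (p : positive) (c : Z) (v s : seq Z) :
    prime (Pos.to_nat p) -> irreducible_check p c v s ->
  irreducible_poly (zpoly rat s).
Proof.
move=> pr_p /and3P[]; set n := (size s).-1; set t := map _ _ => n0 /eqP cs.
set w := zXpXmod _ _ _ _ => /(@zpoly0 'F_(Pos.to_nat p)).
set F := 'F_(Pos.to_nat p).
have sn : size s = n.+1 by move: n0; rewrite /n; case: (size s).
have p0 : Zr (Zpos p) = 0 :> F.
  by rewrite /Zr /= -pmulrn; apply: pchar_Fp_0.
have cs1 : Zr c * Zr (last Z0 s) = 1 :> F.
  rewrite -ZrM (Z_div_mod_eq_full (Z.mul c _) (Zpos p)) cs ZrD ZrM p0 mul0r add0r.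
  by rewrite /Zr.
have s0 : Zr (last Z0 s) != 0 :> F.
  by apply: contra_eq_neq cs1 => ->; rewrite mulr0 eq_sym oner_neq0.
have c0 : Zr c != 0 :> F.
  by apply: contra_eq_neq cs1 => ->; rewrite mul0r eq_sym oner_neq0.
have st : size t = n.
  by rewrite size_map size_takel // leq_pred.
have szf : size (zpoly F s) = n.+1.
  rewrite /zpoly (@PolyK _ 0) ?size_map; last by rewrite -[0]/(Zr Z0) last_map.
  exact: sn.
pose f := zpoly F s.
have ft : f %| 'X^(size t) - zpoly F t.
  have -> : 'X^(size t) - zpoly F t = (Zr c)%:P * f.
    have -> : zpoly F t = - ((Zr c)%:P * zpoly F (take n s)).
      rewrite /t; elim: (take n s) => [|a u IH] /=; first by rewrite zpoly_nil mulr0 oppr0.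
      rewrite !zpoly_cons IH; have -> : Zr (Z.opp (Z.mul c a)) = - (Zr c * Zr a) :> F.
        by rewrite -ZrM; apply: rmorphN.
      by rewrite polyCN polyCM; ring.
    have sE : s = take n s ++ [:: last Z0 s].
      rewrite -{1}(cat_take_drop n s) (drop_nth Z0) ?sn // drop_oversize ?sn //.
      by rewrite -nth_last.
    rewrite /f {2}sE zpoly_cat size_takel ?leq_pred // st zpoly_cons zpoly_nil mulr0 addr0.
    rewrite mulrDr mulrCA -polyCM cs1; ring.
  exact: dvdp_mull.
move=> wE; apply: (irreducible_mod_prime pr_p s0).
have cF : #|F| = Pos.to_nat p by apply: card_Fp.
apply: (@irreducible_by_XpX _ _ n./2); first by rewrite szf ltnS.
  by rewrite szf /= -{1}(odd_double_half n); case: (odd n).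
move=> g irr_g gf; rewrite cF; apply/negP => gP.
have wP := zXpXmod_congr (n./2) p0 ft (congr_refl f (zpoly F [:: Z0; Zpos 1])).
have hX : zpoly F [:: Z0; Zpos 1] = 'X.
  by rewrite !zpoly_cons zpoly_nil mulr0 addr0 rmorph0 add0r /Zr /= mulr1.
rewrite hX -/w in wP.
(* Since [g] divides [f] and the product, it divides [w]; as [w * v] is 1 modulo [f], it then
   divides 1. *)
have gw : g %| zpoly F w by rewrite -(dvdp_subl _ gP) (dvdp_trans gf wP).
have := zmulmod_congr p0 ft w v.
move: wE; rewrite zpoly_add zpoly_cons zpoly_nil mulr0 addr0.
have -> : Zr (Zneg 1) = -1 :> F by rewrite /Zr /=.
move/eqP; rewrite polyCN subr_eq0 => /eqP -> /(dvdp_trans gf).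
rewrite dvdp_subl; last first.
  exact: dvdp_mulr.
by rewrite dvdp1 => /eqP sg; case: irr_g; rewrite sg.
Qed.

(** * The three polynomials and their irreducibility modulo 31 *)

Local Open Scope Z_scope.

(** The three polynomials are even; the lists give their coefficients in [Y = y^2], and [zspread]
    returns to [y]. *)
Definition coef_yD : seq Z :=
  [:: -2470693585135788; 1679453964496051893; -2462573171102886288;
      1847147913929328048; -888334179987132288; 302241307009227264;
      -74768143621533696; 13516084620361728; -1721332250836992;
      139442448236544; -6126808596480; 109337116672].

Definition coef_yE : seq Z :=
  [:: -387038865725307; 255845547796716; -1080696123714384; 985178573370432;
      290816529555456; 1229422640467968; -399291497201664; -226953868935168;
      -145914316455936; 84049703993344; -9462031056896; 437348466688].

Definition coef_yF : seq Z :=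
  [:: -6156736033068; 4132620043369020; -28069535202466347; 54174190167055116;
      -44321252355544320; 16893977313239424; -3430375146685440;
      781964817629184; -165954075623424; 16400930701312; -579898179584;
      27334279168].

(** Certificates for [irreducible_check]. They are odd, being inverses, modulo an even polynomial,
    of a product of 11 odd polynomials. *)
Definition inverse_yD : seq Z :=
  [:: 0; 4; 0; 27; 0; 17; 0; 15; 0; 16; 0; 29; 0; 7; 0; 15; 0; 1; 0; 3; 0;
      29].

Definition inverse_yE : seq Z :=
  [:: 0; 23; 0; 11; 0; 25; 0; 20; 0; 6; 0; 25; 0; 17; 0; 11; 0; 17; 0; 7;
      0; 25].

Definition inverse_yF : seq Z :=
  [:: 0; 24; 0; 17; 0; 12; 0; 27; 0; 9; 0; 1; 0; 16; 0; 17; 0; 3; 0; 22;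
      0; 17].

Local Close Scope Z_scope.

(** No zero follows the final coefficient, so that [last] still gives the leading coefficient in
    [irreducible_check]. *)
Fixpoint zspread (s : seq Z) : seq Z :=
  if s is c :: s' then if s' is [::] then s else [:: c, Z0 & zspread s']
  else [::].

Lemma zpoly_cons2 (R : comNzRingType) c s :
  zpoly R [:: c, Z0 & s] = (Zr c)%:P + 'X^2 * zpoly R s.
Proof. by rewrite !zpoly_cons rmorph0 add0r mulrA. Qed.

Lemma zpoly1 (R : comNzRingType) c : zpoly R [:: c] = (Zr c)%:P.
Proof. by rewrite zpoly_cons zpoly_nil mulr0 addr0. Qed.

Lemma horner_zspread (R : comNzRingType) s (x : R) :
  (zpoly R (zspread s)).[x] = (zpoly R s).[x ^+ 2].
Proof.
elim: s => [|c s IH]; first by rewrite !zpoly_nil !horner0.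
case: s IH => [|d s] IH; first by rewrite !zpoly1 !hornerC.
have -> : zspread [:: c, d & s] = [:: c, Z0 & zspread (d :: s)] by [].
by rewrite zpoly_cons2 (zpoly_cons _ c) !(hornerD, hornerC, hornerM, hornerXn, hornerX) IH.
Qed.

Lemma ZrNeg (R : pzRingType) p : Zr (Zneg p) = - Zr (Zpos p) :> R.
Proof. by rewrite -rmorphN. Qed.

Lemma P_yDE : P_yD = zpoly rat (zspread coef_yD).
Proof.
rewrite /P_yD /= !zpoly_cons2 zpoly1; have := @ZrNeg rat.
(* With [Zr] abstracted, [ring] treats the large constants as atoms. *)
by move: (@Zr rat) => z zN; rewrite !zN -!mul_polyC; ring.
Qed.

Lemma P_yEE : P_yE = zpoly rat (zspread coef_yE).
Proof.
rewrite /P_yE /= !zpoly_cons2 zpoly1; have := @ZrNeg rat.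
by move: (@Zr rat) => z zN; rewrite !zN -!mul_polyC; ring.
Qed.

Lemma P_yFE : P_yF = zpoly rat (zspread coef_yF).
Proof.
rewrite /P_yF /= !zpoly_cons2 zpoly1; have := @ZrNeg rat.
by move: (@Zr rat) => z zN; rewrite !zN -!mul_polyC; ring.
Qed.

Lemma irreducible_yD : irreducible_poly P_yD.
Proof.
rewrite P_yDE; apply: (@irreducible_checkP 31 18 inverse_yD _); first by [].
by vm_compute.
Qed.

Lemma irreducible_yE : irreducible_poly P_yE.
Proof.
rewrite P_yEE; apply: (@irreducible_checkP 31 20 inverse_yE _); first by [].
by vm_compute.
Qed.

Lemma irreducible_yF : irreducible_poly P_yF.
Proof.
rewrite P_yFE; apply: (@irreducible_checkP 31 10 inverse_yF _); first by [].
by vm_compute.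
Qed.

(** * Evaluation of integer polynomials at a real number *)

Lemma zpoly_eq (R : comNzRingType) s t :
  all (eq_op^~ 0) (zadd s (zscale (Zneg 1) t)) -> zpoly R s = zpoly R t.
Proof.
move/(@zpoly0 R)/eqP; rewrite zpoly_add zpoly_scale ZrNeg polyCN mulN1r.
by rewrite subr_eq0 => /eqP.
Qed.

(* Quotient by increasing powers, the first [k] coefficients: it is exact when
   [d] divides [s] in [Z[X]]. *)
Fixpoint zdiv (k : nat) (s d : seq Z) : seq Z :=
  if k is k'.+1 then
    let c := Z.div (head Z0 s) (head Z0 d) in
    c :: zdiv k' (behead (zadd s (zmul d [:: Z.opp c]))) d
  else [::].

(** The quotient is a certificate, checked by multiplying back. *)
Definition zdvd (d s : seq Z) : bool :=
  all (eq_op^~ 0) (zadd s (zscale (Zneg 1) (zmul d (zdiv (size s) s d)))).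

(* The triple of [d^(size s)] and of [a], [b] such that
   [d^(size s) * s(Y) = d * (a + b * sigma)], where [d * Y = p + q * sigma] and
   [q' = q * sigma^2]. *)
Fixpoint zhom (s d p q q' : seq Z) : seq Z * (seq Z * seq Z) :=
  if s is c :: s' then
    let: (w, (a, b)) := zhom s' d p q q' in
    (zmul d w, (zadd (zscale c w) (zadd (zmul p a) (zmul q' b)),
                zadd (zmul q a) (zmul p b)))
  else ([:: Zpos 1], ([::], [::])).

(* A lower bound for [k^(size s) * s(x)] when [l <= k x <= h] and [0 <= l]. *)
Fixpoint zlow (l h k : Z) (s : seq Z) : Z :=
  if s is c :: s' then
    let e := zlow l h k s' in
    Z.add (Z.mul c (Z.pow k (Z.of_nat (size s))))
          (Z.mul (if Z.leb 0 e then l else h) e)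
  else Z0.

Section Evaluation.

Variables (R : realType) (x : R).

Definition zev (s : seq Z) : R := (zpoly R s).[x].

Lemma zev_nil : zev [::] = 0.
Proof. by rewrite /zev zpoly_nil horner0. Qed.

Lemma zev_cons c s : zev (c :: s) = Zr c + x * zev s.
Proof. by rewrite /zev zpoly_cons !hornerE. Qed.

Lemma zev_add s t : zev (zadd s t) = zev s + zev t.
Proof. by rewrite /zev zpoly_add hornerD. Qed.

Lemma zev_scale c s : zev (zscale c s) = Zr c * zev s.
Proof. by rewrite /zev zpoly_scale hornerM hornerC. Qed.

Lemma zev_mul s t : zev (zmul s t) = zev s * zev t.
Proof. by rewrite /zev zpoly_mul hornerM. Qed.

Definition zevE := (zev_add, zev_scale, zev_mul).

Lemma zdvd_root d s : zdvd d s -> zev d = 0 -> zev s = 0.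
Proof. by move=> /(@zpoly_eq R) ds d0; rewrite /zev ds -/(zev _) zev_mul d0 mul0r. Qed.

Lemma zhomP s d p q q' (sigma Y : R) :
    zev d * Y = zev p + zev q * sigma -> zev q * sigma ^+ 2 = zev q' ->
  let: (w, (a, b)) := zhom s d p q q' in
  zev w = zev d ^+ size s /\
  zev d ^+ size s * (zpoly R s).[Y] = zev d * (zev a + zev b * sigma).
Proof.
move=> dY q'E; elim: s => [|c s] /=.
  by rewrite zev_cons zev_nil zpoly_nil horner0 mul0r !(mulr0, addr0).
case: zhom => w [a b] [wE IH]; rewrite zpoly_cons !hornerE !zevE wE exprS; split=> //.
have -> : zev d * zev d ^+ size s * (Zr c + Y * (zpoly R s).[Y]) =
   zev d * (Zr c * zev d ^+ size s + Y * (zev d ^+ size s * (zpoly R s).[Y])) by ring.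
by rewrite IH [Y * _]mulrCA mulrA dY -q'E; ring.
Qed.

(** When [den * sigma = - num], the polynomial [den * a - num * b] takes the value
    [den * (a + b * sigma)], which has to vanish at the roots of [f]. *)
Definition zhom_check (f num den s d p q q' : seq Z) : bool :=
  let: (_, (a, b)) := zhom s d p q q' in
  zdvd f (zadd (zmul den a) (zscale (Zneg 1) (zmul num b))).

Lemma root_zhom f num den s d p q q' (sigma y : R) :
    zhom_check f num den s d p q q' -> zev f = 0 -> zev d != 0 -> zev den != 0 ->
    zev den * sigma = - zev num ->
    zev d * y ^+ 2 = zev p + zev q * sigma -> zev q * sigma ^+ 2 = zev q' ->
  root (zpoly R (zspread s)) y.
Proof.
rewrite /zhom_check => chk f0 d0 den0 sE dy q'E; apply/eqP.
rewrite horner_zspread; move: (zhomP s dy q'E) chk.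
case: zhom => w [a b] [_ E] /zdvd_root/(_ f0); rewrite !zevE ZrNeg => ab0.
apply: (mulfI (expf_neq0 (size s) d0)); rewrite E mulr0.
apply: (mulfI den0); rewrite mulr0 mulrCA.
have -> : zev den * (zev a + zev b * sigma) =
  zev den * zev a + zev b * (zev den * sigma) by ring.
rewrite sE (_ : _ + _ = 0) ?mulr0 // -[RHS]ab0 (_ : Zr 1 = 1) //; ring.
Qed.

Lemma Zr_ge0 z : Z.leb 0 z -> 0 <= Zr z :> R.
Proof. by case: z => // p _; apply: ler0n. Qed.

Lemma Zr_le a b : Z.leb a b -> Zr a <= Zr b :> R.
Proof.
move=> ab; rewrite -subr_ge0 -rmorphB; apply: Zr_ge0.
by rewrite -[(b - a)%R]/(Z.sub b a); lia.
Qed.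

Lemma Zr_pow k n : Zr (Z.pow k (Z.of_nat n)) = Zr k ^+ n :> R.
Proof.
elim: n => [|n IH] //; rewrite exprS -IH -ZrM; congr Zr.
by rewrite Nat2Z.inj_succ Z.pow_succ_r //; lia.
Qed.

(** In Horner's scheme the bound [e] of the tail is multiplied by [k x]; the product is least at [l]
    if [e] is nonnegative, at [h] otherwise. *)
Lemma zlowP l h k s : Z.leb 0 l -> Zr l <= Zr k * x -> Zr k * x <= Zr h ->
  Zr (zlow l h k s) <= Zr k ^+ size s * zev s.
Proof.
move=> /Zr_ge0 l0 lx xh; elim: s => [|c s IH].
  by rewrite zev_nil mulr0.
set e := zlow l h k s in IH *.
have -> : zlow l h k (c :: s) =
    Z.add (Z.mul c (Z.pow k (Z.of_nat (size s).+1)))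
          (Z.mul (if Z.leb 0 e then l else h) e) by [].
rewrite ZrD !ZrM Zr_pow.
rewrite zev_cons mulrDr -[(size (c :: s))]/(size s).+1 [Zr c * _]mulrC lerD2l.
have -> : Zr k ^+ size (c :: s) * (x * zev s) = Zr k * x * (Zr k ^+ size s * zev s).
  by rewrite exprS; ring.
apply: (@le_trans _ _ (Zr k * x * Zr e)); last first.
  by rewrite ler_wpM2l // (le_trans l0).
case: ifP => e0; first by rewrite ler_wpM2r // Zr_ge0.
rewrite ler_wnM2r // -oppr_ge0 -rmorphN Zr_ge0 //.
by rewrite -[(- _)%R]/(Z.opp _); lia.
Qed.

End Evaluation.

(** Bounds in hundredths; the unit subtracted at either end absorbs the error of the
    approximation. *)
Lemma approx15_bounds (R : realType) (x : R) m l h :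
    approx15 x m -> Z.leb (Z.add (Z.mul l (10 ^ 13)) 1) m ->
    Z.leb m (Z.sub (Z.mul h (10 ^ 13)) 1) ->
  Zr l <= 100%:R * x /\ 100%:R * x <= Zr h.
Proof.
rewrite /approx15 ler_norml => /andP[xl xh] /(Zr_le R) ml /(Zr_le R) mh.
have E13 : Zr (10 ^ 13) = 10%:R ^+ 13 :> R by rewrite (_ : 10%:R = Zr (Zpos 10)) // -Zr_pow.
move: ml mh; rewrite ZrD -[Z.sub _ _]/(Z.add _ (Zneg 1)) ZrD (ZrM _ l) (ZrM _ h) E13.
rewrite ZrNeg (_ : Zr 1 = 1 :> R) // => ml mh.
have e15 : 10%:R ^+ 15 = 100%:R * 10%:R ^+ 13 :> R by rewrite !exprS; ring.
have e13 : 0 < 10%:R ^+ 13 :> R by rewrite exprn_gt0.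
move: xl xh; rewrite e15; move: (10%:R ^+ 13) e13 ml mh => e e0 ml mh.
have e1 : e != 0 by rewrite gt_eqF.
have -> : Zr m / (100%:R * e) = (Zr m / e) / 100%:R by field.
have -> : (100%:R * e)^-1 = e^-1 / 100%:R by field.
have ml' : Zr l + e^-1 <= Zr m / e.
  by rewrite ler_pdivlMr // mulrDl mulVf.
have mh' : Zr m / e <= Zr h - e^-1.
  by rewrite ler_pdivrMr // mulrBl mulVf.
move: (Zr m / e) (e^-1) (Zr l) (Zr h) ml' mh' => a b c d; lra.
Qed.

(** * The parametrization of the Harborth configurations *)

Section Configuration.

Variable (R : realType).
Implicit Types (r x y t T : R).

Lemma sqr_sqrt3 r x k : r ^+ 2 = 3%:R -> 0 < k * r -> 0 < x ->
  x ^+ 2 = 3%:R * k ^+ 2 -> x = k * r.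
Proof.
move=> r2 kr0 x0 xE; apply/eqP; rewrite -subr_eq0.
have : (x - k * r) * (x + k * r) = 0.
  have -> : (x - k * r) * (x + k * r) = x ^+ 2 - k ^+ 2 * r ^+ 2 by ring.
  by rewrite xE r2; ring.
by move/eqP; rewrite mulf_eq0 => /orP[//|]; rewrite gt_eqF // addr_gt0.
Qed.

(* The apex [h] of an equilateral triangle over [g] is [g] rotated by 60
   degrees, with the orientation given by the sign of the cross product. *)
Lemma equilateral_apex r (L g1 g2 h1 h2 : R) :
    r ^+ 2 = 3%:R -> 0 < r -> 0 < L ->
    g1 ^+ 2 + g2 ^+ 2 = L -> h1 ^+ 2 + h2 ^+ 2 = L ->
    (g1 - h1) ^+ 2 + (g2 - h2) ^+ 2 = L -> 0 < g1 * h2 - g2 * h1 ->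
  h1 = g1 / 2%:R - r * g2 / 2%:R.
Proof.
move=> r2 r0 L0 gE hE ghE cr.
have dot : g1 * h1 + g2 * h2 = L / 2%:R by lra.
have cross : g1 * h2 - g2 * h1 = L / 2%:R * r.
  apply: sqr_sqrt3 => //; first by rewrite mulr_gt0 // divr_gt0.
  have -> : (g1 * h2 - g2 * h1) ^+ 2 = (g1 ^+ 2 + g2 ^+ 2) * (h1 ^+ 2 + h2 ^+ 2)
     - (g1 * h1 + g2 * h2) ^+ 2 by ring.
  by rewrite gE hE dot; field.
apply: (mulfI (lt0r_neq0 L0)); rewrite -{1}gE.
have -> : (g1 ^+ 2 + g2 ^+ 2) * h1 =
   g1 * (g1 * h1 + g2 * h2) - g2 * (g1 * h2 - g2 * h1) by ring.
by rewrite dot cross; field.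
Qed.

(** Coordinates in the orthonormal frame [(-t, T)], [(T, t)]: the first is [k], the norm gives the
    square of the second, and positivity its sign. *)
Lemma unit_frame r t T u v c k :
    r ^+ 2 = 3%:R -> 0 < c * r -> t ^+ 2 + T ^+ 2 = 1 ->
    - t * u + T * v = k -> u ^+ 2 + v ^+ 2 = k ^+ 2 + 3%:R * c ^+ 2 ->
    0 < T * u + t * v ->
  u = c * r * T - k * t /\ v = k * T + c * r * t.
Proof.
move=> r2 cr0 tT kE uv cr.
have cross : T * u + t * v = c * r.
  apply: sqr_sqrt3 => //.
  have -> : (T * u + t * v) ^+ 2 =
    (t ^+ 2 + T ^+ 2) * (u ^+ 2 + v ^+ 2) - (- t * u + T * v) ^+ 2 by ring.
  by rewrite tT uv kE; ring.
split.
  rewrite -[u]mul1r -tT.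
  have -> : (t ^+ 2 + T ^+ 2) * u = (T * u + t * v) * T - (- t * u + T * v) * t by ring.
  by rewrite cross kE.
rewrite -[v]mul1r -tT.
have -> : (t ^+ 2 + T ^+ 2) * v = (- t * u + T * v) * T + (T * u + t * v) * t by ring.
by rewrite cross kE.
Qed.

(** For the form [3 x^2 + y^2], a point at distance 1 from both 0 and [E] lies on the perpendicular
    bisector of these, which passes through [E / 2] with direction [(- ey, 3 ex)]. *)
Lemma rhombus_tip (ex ey fx fy : R) :
    let n := 3%:R * ex ^+ 2 + ey ^+ 2 in n != 0 ->
    3%:R * fx ^+ 2 + fy ^+ 2 = 1 ->
    3%:R * (ex - fx) ^+ 2 + (ey - fy) ^+ 2 = 1 ->
  exists s, [/\ fx = ex / 2%:R - s * ey, fy = ey / 2%:R + 3%:R * s * ex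
              & 12%:R * n * s ^+ 2 = 4%:R - n].
Proof.
move=> n n0 fE efE; exists ((ex * fy - ey * fx) / n).
have dot : 3%:R * ex * fx + ey * fy = n / 2%:R by rewrite /n; lra.
have fxE : fx = ex / 2%:R - (ex * fy - ey * fx) / n * ey.
  apply: (mulfI n0).
  have -> : n * fx = ex * (3%:R * ex * fx + ey * fy) - (ex * fy - ey * fx) * ey.
    by rewrite /n; ring.
  by rewrite dot; field.
have fyE : fy = ey / 2%:R + 3%:R * ((ex * fy - ey * fx) / n) * ex.
  apply: (mulfI n0).
  have -> : n * fy = ey * (3%:R * ex * fx + ey * fy) + 3%:R * (ex * fy - ey * fx) * ex.
    by rewrite /n; ring.
  by rewrite dot; field.
split=> //; move: fxE fyE fE; set s := (_ / n) => -> -> fE.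
by rewrite /n; move: s fE => s fE; lra.
Qed.

(* [a] and [b] are the coordinates of [D - F], those of [G - F] are [g] and
   [(b - a) / 2]; eliminating [g] from the two circles leaves a quartic. *)
Lemma two_circles_quartic (a b g : R) :
    3%:R * g ^+ 2 + ((b - a) / 2%:R) ^+ 2 = 1 ->
    3%:R * (g - a) ^+ 2 + ((b - a) / 2%:R - b) ^+ 2 = 4%:R ->
  4%:R * a ^+ 2 * (3%:R * a ^+ 2 + b ^+ 2) - 30%:R * a ^+ 2 - 6%:R * a * b + 9%:R = 0.
Proof.
move=> h1 h2.
have ag : 3%:R * a * g = (3%:R * a ^+ 2 + a * b - 3%:R) / 2%:R by lra.
have : (3%:R * a * g) ^+ 2 + 3%:R * a ^+ 2 * ((b - a) / 2%:R) ^+ 2 =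
    3%:R * a ^+ 2 * (3%:R * g ^+ 2 + ((b - a) / 2%:R) ^+ 2) by ring.
by rewrite h1 ag; lra.
Qed.

(** If [T] and [sqrt 3 * th] are the cosine and sine of an angle, [sqrt 3 * m] is the tangent of its
    half. *)
Lemma half_angle (T th : R) : 0 < 1 + T -> T ^+ 2 + 3%:R * th ^+ 2 = 1 ->
  let m := th / (1 + T) in let q := 1 + 3%:R * m ^+ 2 in
  q * T = 1 - 3%:R * m ^+ 2 /\ q * th = 2%:R * m.
Proof.
move=> T0 TE m q; have T1 : 1 + T != 0 by rewrite gt_eqF.
have m2 : 3%:R * m ^+ 2 = (1 - T) / (1 + T).
  apply: (mulfI (expf_neq0 2 T1)); rewrite /m expr_div_n.
  have -> : (1 + T) ^+ 2 * (3%:R * (th ^+ 2 / (1 + T) ^+ 2)) = 3%:R * th ^+ 2 by field.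
  have -> : 3%:R * th ^+ 2 = 1 - T ^+ 2 by lra.
  by field.
by rewrite /q m2 /m; split; field.
Qed.

End Configuration.

(** * Polynomials in the parameter [m] and elimination of [sigma] *)

Local Open Scope Z_scope.

(* [T = num_Ex / q], [E = (num_Ex, num_Ey) / q], [D = (num_Dx, num_Dy) / (2 q)]
   and [|E|^2 = num_EE / q^2], with abscissae divided by [sqrt 3]; the parameter
   [sigma] of [F] satisfies [12 num_EE sigma^2 = num_C]. *)
Definition num_q : seq Z := [:: 1; 0; 3].
Definition num_Ex : seq Z := [:: 1; 0; -3].
Definition num_Ey : seq Z := [:: 2; 6; -6].
Definition num_Dx : seq Z := [:: 3; 2; -9].
Definition num_Dy : seq Z := [:: 3; 18; -9].
Definition num_EE : seq Z := [:: 7; 24; -6; -72; 63].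
Definition num_C : seq Z :=
  zadd (zscale 4 (zmul num_q num_q)) (zscale (-1) num_EE).

Definition minpoly_m : seq Z :=
  [:: -122803; -1891006; -8577841; 2301084; 103766319; 72164970; -838523691;
      -733360176; 5435461746; 5126170212; -23980779162; -20705639256;
      71942337486; 46135531908; -146757467142; -59402174256; 203761256913;
      52608263130; -226936939653; 15097412124; 168837644403; -111662013294;
      21754183041].

Definition sigma_num : seq Z :=
  [:: -123; -1044; -958; 5196; 7299; -2664; -900; 7992; 65691; -140292;
      -77598; 253692; -89667].

Definition sigma_den : seq Z :=
  [:: -260; -2552; -6360; -7608; -39132; -55152; 197424; 165456; -352188;
      205416; -515160; 620136; -189540].

Local Close Scope Z_scope.

Lemma zhom_yD : zhom_check minpoly_m sigma_num sigma_den coef_yD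
  (zscale 4 (zmul num_q num_q)) (zmul num_Dy num_Dy) [::] [::].
Proof. by vm_compute. Qed.

Lemma zhom_yE : zhom_check minpoly_m sigma_num sigma_den coef_yE
  (zmul num_q num_q) (zmul num_Ey num_Ey) [::] [::].
Proof. by vm_compute. Qed.

(** Obtained by squaring [fy = ey / 2 + 3 sigma ex], multiplying by [4 num_EE q^2] and replacing
    [12 num_EE sigma^2] by [num_C]. Unlike the squares of [dy] and [ey], this one involves
    [sigma]. *)
Lemma zhom_yF : zhom_check minpoly_m sigma_num sigma_den coef_yF
  (zscale 4 (zmul num_EE (zmul num_q num_q)))
  (zadd (zmul num_EE (zmul num_Ey num_Ey)) (zscale 3 (zmul num_C (zmul num_Ex num_Ex))))
  (zscale 12 (zmul num_EE (zmul num_Ex num_Ey)))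
  (zmul num_C (zmul num_Ex num_Ey)).
Proof. by vm_compute. Qed.

Local Arguments zadd : simpl never.
Local Arguments zscale : simpl never.
Local Arguments zmul : simpl never.

(* Pairs [(u, v)] stand for [u + v * tau] with [tau ^ 2 = d]. *)
Definition qadd (u v : seq Z * seq Z) := (zadd u.1 v.1, zadd u.2 v.2).

Definition qscale (c : seq Z) (u : seq Z * seq Z) := (zmul c u.1, zmul c u.2).

Definition qmul (d : seq Z) (u v : seq Z * seq Z) :=
  (zadd (zmul u.1 v.1) (zmul d (zmul u.2 v.2)),
   zadd (zmul u.1 v.2) (zmul u.2 v.1)).

Section QuadraticExtension.

Variables (R : realType) (x tau : R) (d : seq Z).
Hypothesis tau2 : tau ^+ 2 = zev x d.

Definition qev (u : seq Z * seq Z) : R := zev x u.1 + zev x u.2 * tau.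

Lemma qev_add u v : qev (qadd u v) = qev u + qev v.
Proof. by rewrite /qev !zevE; ring. Qed.

Lemma qev_scale c u : qev (qscale c u) = zev x c * qev u.
Proof. by rewrite /qev !zevE; ring. Qed.

Lemma qev_mul u v : qev (qmul d u v) = qev u * qev v.
Proof. by rewrite /qev !zevE -tau2; ring. Qed.

Lemma zev1 c : zev x [:: c] = Zr c.
Proof. by rewrite zev_cons zev_nil mulr0 addr0. Qed.

Definition qevE := (qev_add, qev_scale, qev_mul).

End QuadraticExtension.

Section Elimination.

Local Open Scope Z_scope.

(* With [tau = 12 n sigma], these are [24 n q] times the coordinates of [D - F]. *)
Definition num_n : seq Z := zscale 12 num_EE.
Definition num_tau2 : seq Z := zmul num_n num_C.
Definition num_Wx : seq Z * seq Z :=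
  (zmul num_n (zadd num_Dx (zscale (-1) num_Ex)), zscale 2 num_Ey).
Definition num_Wy : seq Z * seq Z :=
  (zmul num_n (zadd num_Dy (zscale (-1) num_Ey)), zscale (-6) num_Ex).
Definition num_scale2 : seq Z := zmul (zmul num_q num_n) (zmul num_q num_n).

(** The quartic of [two_circles_quartic] times [(24 num_EE q)^4], which is [16 num_scale2^2]; hence
    the constants [24 = 6 * 4] and [144 = 9 * 16]. *)
Definition num_quartic : seq Z * seq Z :=
  let sqr := qmul num_tau2 num_Wx num_Wx in
  qadd
    (qmul num_tau2 (qscale [:: 4] sqr)
       (qadd (qscale [:: 3] sqr) (qmul num_tau2 num_Wy num_Wy)))
    (qadd
       (qscale (zscale (-24) num_scale2)
          (qmul num_tau2 num_Wx (qadd (qscale [:: 5] num_Wx) num_Wy)))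
       (zscale 144 (zmul num_scale2 num_scale2), [::])).

Lemma num_quartic1 (R : realType) : zpoly R num_quartic.1 =
  zpoly R (zscale 2304 (zmul num_EE (zmul num_n (zmul num_n sigma_num)))).
Proof. by apply: zpoly_eq; vm_compute. Qed.

Lemma num_quartic2 (R : realType) : zpoly R num_quartic.2 =
  zpoly R (zscale 2304 (zmul num_EE (zmul num_n sigma_den))).
Proof. by apply: zpoly_eq; vm_compute. Qed.

(** The resultant in [sigma] of [sigma_den * sigma + sigma_num] and [num_n * sigma^2 - num_C]. *)
Definition sigma_resultant : seq Z :=
  zadd (zmul num_n (zmul sigma_num sigma_num))
       (zscale (-1) (zmul num_C (zmul sigma_den sigma_den))).

Lemma sigma_resultantE (R : realType) : zpoly R sigma_resultant =
  zpoly R (zscale (-4) (zmul (zmul num_q num_q) (zmul num_Dy minpoly_m))).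
Proof. by apply: zpoly_eq; vm_compute. Qed.

Local Close Scope Z_scope.

Variables (R : realType) (m s a b : R).
Local Notation ev := (zev m).

Hypotheses (q0 : ev num_q != 0) (n0 : ev num_EE != 0) (Dy0 : ev num_Dy != 0).
Hypothesis s2 : 12%:R * ev num_EE * s ^+ 2 = ev num_C.
Hypothesis aE : 2%:R * ev num_q * a = ev num_Dx - ev num_Ex + 2%:R * ev num_Ey * s.
Hypothesis bE : 2%:R * ev num_q * b = ev num_Dy - ev num_Ey - 6%:R * ev num_Ex * s.
Hypothesis abE : 4%:R * a ^+ 2 * (3%:R * a ^+ 2 + b ^+ 2) - 30%:R * a ^+ 2
  - 6%:R * a * b + 9%:R = 0.

Lemma sigma_linear : ev sigma_den * s = - ev sigma_num.
Proof.
pose tau := 12%:R * ev num_EE * s.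
have tau2 : tau ^+ 2 = ev num_tau2.
  by rewrite /num_tau2 zev_mul -s2 /num_n zev_scale -[Zr 12]/(12%:R) /tau; ring.
have WxE : qev m tau num_Wx = 24%:R * ev num_EE * ev num_q * a.
  have -> : 24%:R * ev num_EE * ev num_q * a =
            12%:R * ev num_EE * (2%:R * ev num_q * a) by ring.
  rewrite aE /qev /num_Wx /= !zevE !ZrNeg /tau.
  by rewrite -[Zr 1]/(1%:R) -[Zr 2]/(2%:R) -[Zr 12]/(12%:R); ring.
have WyE : qev m tau num_Wy = 24%:R * ev num_EE * ev num_q * b.
  have -> : 24%:R * ev num_EE * ev num_q * b =
            12%:R * ev num_EE * (2%:R * ev num_q * b) by ring.
  rewrite bE /qev /num_Wy /= !zevE !ZrNeg /tau.
  by rewrite -[Zr 1]/(1%:R) -[Zr 6]/(6%:R) -[Zr 12]/(12%:R); ring.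
have scale2E : ev num_scale2 = (ev num_q * (12%:R * ev num_EE)) ^+ 2.
  by rewrite /num_scale2 zev_mul !(zev_mul _ num_q) /num_n zev_scale.
have : qev m tau num_quartic = 0.
  rewrite /num_quartic !(qevE tau2) WxE WyE /qev.
  move: num_scale2 scale2E => S2 S2E.
  rewrite /= zev_nil !zevE !zev1 S2E ZrNeg.
  rewrite -[Zr 4]/(4%:R) -[Zr 3]/(3%:R) -[Zr 5]/(5%:R) -[Zr 24]/(24%:R).
  rewrite -[Zr 144]/(144%:R) mul0r addr0.
  set e := ev num_EE; set q := ev num_q.
  transitivity ((24%:R * e * q) ^+ 4 * (4%:R * a ^+ 2 * (3%:R * a ^+ 2 + b ^+ 2)
    - 30%:R * a ^+ 2 - 6%:R * a * b + 9%:R)); first by ring.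
  by rewrite abE mulr0.
rewrite /qev /zev num_quartic1 num_quartic2 -!/(zev _ _) !zevE -[Zr 12]/(12%:R) /tau.
have Z0' : Zr 2304 != 0 :> R by rewrite -[Zr 2304]/(2304%:R) pnatr_eq0.
move: (Zr 2304) Z0' => c c0 E.
(* As [tau = num_n * sigma], this is the common factor of both components of the quartic. *)
have e0 : c * ev num_EE * (12%:R * ev num_EE) ^+ 2 != 0.
  by rewrite !(mulf_neq0, expf_neq0) ?pnatr_eq0.
apply/eqP; rewrite -subr_eq0 opprK; apply/eqP/(mulfI e0); rewrite mulr0 -[RHS]E.
by ring.
Qed.

Lemma minpoly_m_eq0 : ev minpoly_m = 0.
Proof.
have lhsE : ev sigma_resultant = 12%:R * ev num_EE * ev sigma_num ^+ 2
    - (4%:R * ev num_q ^+ 2 - ev num_EE) * ev sigma_den ^+ 2.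
  rewrite /sigma_resultant /num_n /num_C !zevE !ZrNeg.
  by rewrite -[Zr 1]/(1%:R) -[Zr 4]/(4%:R) -[Zr 12]/(12%:R); ring.
have rhsE : ev (zscale (Zneg 4) (zmul (zmul num_q num_q) (zmul num_Dy minpoly_m)))
    = - (4%:R * ev num_q ^+ 2 * ev num_Dy * ev minpoly_m).
  by rewrite !zevE ZrNeg -[Zr 4]/(4%:R); ring.
have E := congr1 (horner^~ m) (sigma_resultantE R).
have {lhsE rhsE}E := etrans (esym lhsE) (etrans E rhsE).
have CE : 12%:R * ev num_EE * s ^+ 2 = 4%:R * ev num_q ^+ 2 - ev num_EE.
  rewrite s2 /num_C !zevE ZrNeg -[Zr 1]/(1%:R) -[Zr 4]/(4%:R); ring.
(* After substitution of [- sigma_den * s] for [sigma_num], the two terms of the resultant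
   cancel. *)
move: E; rewrite -CE -[ev sigma_num]opprK -sigma_linear => E.
have : 4%:R * ev num_q ^+ 2 * ev num_Dy * ev minpoly_m = 0 by lra.
move/eqP; rewrite !mulf_eq0 pnatr_eq0 (negPf q0) (negPf Dy0) /=.
by move/eqP.
Qed.

End Elimination.

(** * From the geometric system and the decimals to the roots *)

Local Arguments zspread : simpl never.

(** [sigma_den] is negative on [[0.50, 0.52]]: [zlow] gives a positive lower bound for its
    opposite. *)
Lemma sigma_den_neq0 (R : realType) (m : R) :
  50%:R <= 100%:R * m -> 100%:R * m <= 52%:R -> zev m sigma_den != 0.
Proof.
move=> m1 m2; have := @zlowP R m 50 52 100 (zscale (Zneg 1) sigma_den) isT m1 m2.
have low0 : 0 < Zr (zlow 50 52 100 (zscale (Zneg 1) sigma_den)) :> R.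
  by apply: (@lt_le_trans _ _ 1); [exact: ltr01 | apply: (@Zr_le R 1); vm_compute].
move/(lt_le_trans low0); rewrite zev_scale; case: eqP => // ->.
by rewrite !mulr0 ltxx.
Qed.

Lemma Zr_small (R : pzRingType) :
  (Zr 0 = 0 :> R) * (Zr 1 = 1 :> R) * (Zr 2 = 2%:R :> R) *
  (Zr 3 = 3%:R :> R) * (Zr 4 = 4%:R :> R) * (Zr 6 = 6%:R :> R) *
  (Zr 7 = 7%:R :> R) * (Zr 9 = 9%:R :> R) * (Zr 12 = 12%:R :> R) *
  (Zr 18 = 18%:R :> R) * (Zr 24 = 24%:R :> R) * (Zr 63 = 63%:R :> R) *
  (Zr 72 = 72%:R :> R).
Proof. by []. Qed.

Lemma zev3 (R : realType) (x : R) a b c :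
  zev x [:: a; b; c] = Zr a + x * (Zr b + x * Zr c).
Proof. by rewrite !zev_cons zev_nil mulr0 addr0. Qed.

(* The system in coordinates where the abscissae are divided by [sqrt 3];
   [E] has abscissa [T]. *)
Lemma roots_of_rational_system (R : realType) (T th dx dy ey fx fy gx gy : R) :
    12%:R <= 100%:R * T -> 100%:R * T <= 13%:R -> 0 < th -> 0 < dy -> 0 < ey ->
    T ^+ 2 + 3%:R * th ^+ 2 = 1 ->
    dx = th / 2%:R + 3%:R / 2%:R * T -> dy = 3%:R / 2%:R * T + 9%:R / 2%:R * th ->
    ey = 2%:R * T + 3%:R * th ->
    3%:R * fx ^+ 2 + fy ^+ 2 = 1 -> 3%:R * (T - fx) ^+ 2 + (ey - fy) ^+ 2 = 1 ->
    3%:R * (fx - gx) ^+ 2 + (fy - gy) ^+ 2 = 1 ->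
    3%:R * (dx - gx) ^+ 2 + (dy - gy) ^+ 2 = 4%:R ->
    gy = (dy + fy) / 2%:R - (dx - fx) / 2%:R ->
  [/\ root (zpoly R (zspread coef_yD)) dy, root (zpoly R (zspread coef_yE)) ey
    & root (zpoly R (zspread coef_yF)) fy].
Proof.
move=> T1 T2 th0 dy0 ey0 T2E dxE dyE eyE hF hEF hFG hDG gyE.
have n0 : 3%:R * T ^+ 2 + ey ^+ 2 != 0.
  rewrite gt_eqF // ltr_wpDl //; first by rewrite mulr_ge0 ?ler0n ?sqr_ge0.
  by rewrite exprn_gt0.
have [s [fxE fyE s2]] := rhombus_tip n0 hF hEF.
have K : 4%:R * (dx - fx) ^+ 2 * (3%:R * (dx - fx) ^+ 2 + (dy - fy) ^+ 2)
   - 30%:R * (dx - fx) ^+ 2 - 6%:R * (dx - fx) * (dy - fy) + 9%:R = 0.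
  apply: (@two_circles_quartic _ _ _ (gx - fx)).
    by rewrite -[RHS]hFG gyE; field.
  by rewrite -[RHS]hDG gyE; field.
have T10 : 0 < 1 + T by lra.
have [] := half_angle T10 T2E; set m := th / (1 + T); set q := 1 + _ => qT qth.
have m0 : 0 < m by rewrite divr_gt0.
have m2T : m ^+ 2 * (1 + T) = (1 - T) / 3%:R.
  by move: qT; rewrite /q => qT; lra.
(* From [3 m^2 = (1 - T) / (1 + T)] and [T] in [[0.12, 0.13]], the parameter lies in the interval of
   [sigma_den_neq0]. *)
have m1 : 50%:R <= 100%:R * m.
  rewrite leNgt; apply/negP => mlt.
  have : m ^+ 2 < (1 / 2%:R) ^+ 2 by rewrite ltr_pXn2r // ?nnegrE; lra.
  rewrite -(ltr_pM2r T10) m2T; lra.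
have m2 : 100%:R * m <= 52%:R.
  rewrite leNgt; apply/negP => mgt.
  have : (52%:R / 100%:R) ^+ 2 < m ^+ 2 by rewrite ltr_pXn2r // ?nnegrE; lra.
  rewrite -(ltr_pM2r T10) m2T; lra.
have q0 : 0 < q by rewrite ltr_wpDr // mulr_ge0 ?ler0n ?sqr_ge0.
have evq : zev m num_q = q.
  by rewrite /num_q zev3 !Zr_small /q; ring.
have evEx : zev m num_Ex = q * T.
  by rewrite qT /num_Ex zev3 ?ZrNeg !Zr_small; ring.
have evEy : zev m num_Ey = q * ey.
  rewrite eyE mulrDr mulrCA qT [q * _]mulrCA qth /num_Ey zev3 ?ZrNeg !Zr_small; ring.
have evDx : zev m num_Dx = 2%:R * q * dx.
  have -> : 2%:R * q * dx = q * th + 3%:R * (q * T) by rewrite dxE; field.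
  by rewrite qT qth /num_Dx zev3 ?ZrNeg !Zr_small; ring.
have evDy : zev m num_Dy = 2%:R * q * dy.
  have -> : 2%:R * q * dy = 9%:R * (q * th) + 3%:R * (q * T) by rewrite dyE; field.
  by rewrite qT qth /num_Dy zev3 ?ZrNeg !Zr_small; ring.
have evEE : zev m num_EE = q ^+ 2 * (3%:R * T ^+ 2 + ey ^+ 2).
  have -> : q ^+ 2 * (3%:R * T ^+ 2 + ey ^+ 2) =
     3%:R * zev m num_Ex ^+ 2 + zev m num_Ey ^+ 2 by rewrite evEx evEy; ring.
  by rewrite /num_Ex /num_Ey /num_EE !zev_cons zev_nil ?ZrNeg !Zr_small; ring.
have evC : zev m num_C = 4%:R * q ^+ 2 - zev m num_EE.
  have zC u v : zev m (zadd (zscale 4 (zmul u u)) (zscale (-1) v)) =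
      4%:R * zev m u ^+ 2 - zev m v by rewrite !zevE ?ZrNeg !Zr_small; ring.
  by rewrite -evq; apply: zC.
have qn0 : q != 0 by rewrite gt_eqF.
have evqn0 : zev m num_q != 0 by rewrite evq.
have evEEn0 : zev m num_EE != 0 by rewrite evEE mulf_neq0 ?expf_neq0.
have evDyn0 : zev m num_Dy != 0 by rewrite evDy gt_eqF // !mulr_gt0.
have s2' : 12%:R * zev m num_EE * s ^+ 2 = zev m num_C.
  rewrite evC evEE.
  have -> : 12%:R * (q ^+ 2 * (3%:R * T ^+ 2 + ey ^+ 2)) * s ^+ 2 =
    q ^+ 2 * (12%:R * (3%:R * T ^+ 2 + ey ^+ 2) * s ^+ 2) by ring.
  by rewrite s2; ring.
have aE : 2%:R * zev m num_q * (dx - fx) =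
    zev m num_Dx - zev m num_Ex + 2%:R * zev m num_Ey * s.
  by rewrite evq evDx evEx evEy fxE; field.
have bE : 2%:R * zev m num_q * (dy - fy) =
    zev m num_Dy - zev m num_Ey - 6%:R * zev m num_Ex * s.
  by rewrite evq evDy evEx evEy fyE; field.
have sE := sigma_linear evEEn0 s2' aE bE K.
have N0 := minpoly_m_eq0 evqn0 evEEn0 evDyn0 s2' aE bE K.
have den0 := sigma_den_neq0 m1 m2.
have zd n p : zev m (zscale 4 (zmul n (zmul p p))) = 4%:R * zev m n * zev m p ^+ 2.
  by rewrite !zevE ?ZrNeg !Zr_small; ring.
split.
- have dDE p : zev m (zscale 4 (zmul p p)) = 4%:R * zev m p ^+ 2.
    by rewrite !zevE ?ZrNeg !Zr_small; ring.
  apply: (root_zhom zhom_yD N0 _ den0 sE).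
  + by rewrite dDE mulf_neq0 ?expf_neq0 ?pnatr_eq0.
  + by rewrite dDE zev_mul zev_nil evq evDy; ring.
  + by rewrite zev_nil mul0r.
- apply: (root_zhom zhom_yE N0 _ den0 sE).
  + by rewrite zev_mul mulf_neq0.
  + by rewrite (zev_mul _ num_q) (zev_mul _ num_Ey) zev_nil evq evEy; ring.
  + by rewrite zev_nil mul0r.
- have pFE n c u v : zev m (zadd (zmul n (zmul v v)) (zscale 3 (zmul c (zmul u u))))
      = zev m n * zev m v ^+ 2 + 3%:R * zev m c * zev m u ^+ 2.
    by rewrite !zevE ?ZrNeg !Zr_small; ring.
  have qFE n u v : zev m (zscale 12 (zmul n (zmul u v))) =
      12%:R * zev m n * zev m u * zev m v by rewrite !zevE ?ZrNeg !Zr_small; ring.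
  have qFE' c u v : zev m (zmul c (zmul u v)) = zev m c * zev m u * zev m v.
    by rewrite !zevE mulrA.
  apply: (root_zhom zhom_yF N0 _ den0 sE).
  + by rewrite zd mulf_neq0 ?expf_neq0 // mulf_neq0 ?pnatr_eq0.
  + by rewrite zd pFE qFE -s2' evq evEx evEy fyE; field.
  + by rewrite qFE qFE' -s2'; ring.
Qed.
(** These signs single out the solution: the first two choose the square roots for [D] and [E], the
    next two the orientations of the triangles DGH and FGJ. Two decimals suffice. *)
Lemma harborth_approx_signs (R : realType) (t T : R) (D E F G H J : R * R) :
    harborth_approx t T D E F G H J ->
  [/\ 0 < T * (D.1 - 2%:R * t) + t * D.2,
      0 < T * (E.1 - t) + t * (E.2 - T),
      0 < (D.1 - G.1) * (H.2 - D.2) + (D.2 - G.2) * (D.1 - H.1)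
    & 0 < (F.1 - G.1) * (F.2 - J.2) + (G.2 - F.2) * (F.1 - J.1)] /\
  [/\ 12%:R <= 100%:R * T, 100%:R * T <= 13%:R, 0 < t, 0 < D.2 & 0 < E.2].
Proof.
case: D E F G H J => [D1 D2] [E1 E2] [F1 F2] [G1 G2] [H1 H2] [J1 J2] [[at_ aT]] /=.
move=> [[aD1 aD2] [[aE1 aE2] [[aF1 aF2] [[aG1 aG2] [[aH1 aH2] [aJ1 aJ2]]]]]].
have t0 : 0 < t.
  have [tl tu] : 99%:R <= 100%:R * t /\ 100%:R * t <= 100%:R :=
    approx15_bounds (l := 99) (h := 100) at_ isT isT.
  lra.
have [T1 T2] : 12%:R <= 100%:R * T /\ 100%:R * T <= 13%:R :=
  approx15_bounds (l := 12) (h := 13) aT isT isT.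
have T0 : 0 < T by lra.
have D20 : 0 < D2.
  have [D2l D2u] : 276%:R <= 100%:R * D2 /\ 100%:R * D2 <= 277%:R :=
    approx15_bounds (l := 276) (h := 277) aD2 isT isT.
  lra.
have E20 : 0 < E2.
  have [E2l E2u] : 196%:R <= 100%:R * E2 /\ 100%:R * E2 <= 197%:R :=
    approx15_bounds (l := 196) (h := 197) aE2 isT isT.
  lra.
(* The bound [-1.20 = 0.80 - 2] comes from [D1 - 2 t], and [1.83 = 1.96 - 0.13] from [E2 - T]. *)
have cross_gt0 u v : - 120%:R <= 100%:R * u -> 183%:R <= 100%:R * v ->
    0 < T * u + t * v.
  have [tl tu] : 99%:R <= 100%:R * t /\ 100%:R * t <= 100%:R :=
    approx15_bounds (l := 99) (h := 100) at_ isT isT.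
  move=> u1 v1.
  have : T * (- 120%:R) <= T * (100%:R * u) by rewrite ler_wpM2l // ltW.
  have : t * 183%:R <= t * (100%:R * v) by rewrite ler_wpM2l // ltW.
  lra.
split; last by split.
split.
- apply: cross_gt0.
  + have [tl tu] : 99%:R <= 100%:R * t /\ 100%:R * t <= 100%:R :=
      approx15_bounds (l := 99) (h := 100) at_ isT isT.
    have [D1l D1u] : 80%:R <= 100%:R * D1 /\ 100%:R * D1 <= 82%:R :=
      approx15_bounds (l := 80) (h := 82) aD1 isT isT.
    lra.
  + have [D2l D2u] : 276%:R <= 100%:R * D2 /\ 100%:R * D2 <= 277%:R :=
      approx15_bounds (l := 276) (h := 277) aD2 isT isT.
    lra.
- apply: cross_gt0.
  + have [tl tu] : 99%:R <= 100%:R * t /\ 100%:R * t <= 100%:R :=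
      approx15_bounds (l := 99) (h := 100) at_ isT isT.
    have [E1l E1u] : 20%:R <= 100%:R * E1 /\ 100%:R * E1 <= 21%:R :=
      approx15_bounds (l := 20) (h := 21) aE1 isT isT.
    lra.
  +     have [E2l E2u] : 196%:R <= 100%:R * E2 /\ 100%:R * E2 <= 197%:R :=
      approx15_bounds (l := 196) (h := 197) aE2 isT isT.
    lra.
- apply: addr_gt0; apply: mulr_gt0.
  + have [D1l D1u] : 80%:R <= 100%:R * D1 /\ 100%:R * D1 <= 82%:R :=
      approx15_bounds (l := 80) (h := 82) aD1 isT isT.
    have [G1l G1u] : - 84%:R <= 100%:R * G1 /\ 100%:R * G1 <= - 83%:R :=
      approx15_bounds (l := -84) (h := -83) aG1 isT isT.
    lra.
  + have [H2l H2u] : 362%:R <= 100%:R * H2 /\ 100%:R * H2 <= 363%:R :=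
      approx15_bounds (l := 362) (h := 363) aH2 isT isT.
    have [D2l D2u] : 276%:R <= 100%:R * D2 /\ 100%:R * D2 <= 277%:R :=
      approx15_bounds (l := 276) (h := 277) aD2 isT isT.
    lra.
  + have [D2l D2u] : 276%:R <= 100%:R * D2 /\ 100%:R * D2 <= 277%:R :=
      approx15_bounds (l := 276) (h := 277) aD2 isT isT.
    have [G2l G2u] : 162%:R <= 100%:R * G2 /\ 100%:R * G2 <= 163%:R :=
      approx15_bounds (l := 162) (h := 163) aG2 isT isT.
    lra.
  + have [D1l D1u] : 80%:R <= 100%:R * D1 /\ 100%:R * D1 <= 82%:R :=
      approx15_bounds (l := 80) (h := 82) aD1 isT isT.
    have [H1l H1u] : - 100%:R <= 100%:R * H1 /\ 100%:R * H1 <= - 99%:R :=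
      approx15_bounds (l := -100) (h := -99) aH1 isT isT.
    lra.
- apply: addr_gt0; apply: mulr_gt0.
  + have [F1l F1u] : - 7%:R <= 100%:R * F1 /\ 100%:R * F1 <= - 6%:R :=
      approx15_bounds (l := -7) (h := -6) aF1 isT isT.
    have [G1l G1u] : - 84%:R <= 100%:R * G1 /\ 100%:R * G1 <= - 83%:R :=
      approx15_bounds (l := -84) (h := -83) aG1 isT isT.
    lra.
  + have [F2l F2u] : 99%:R <= 100%:R * F2 /\ 100%:R * F2 <= 100%:R :=
      approx15_bounds (l := 99) (h := 100) aF2 isT isT.
    have [J2l J2u] : 63%:R <= 100%:R * J2 /\ 100%:R * J2 <= 64%:R :=
      approx15_bounds (l := 63) (h := 64) aJ2 isT isT.
    lra.
  + have [G2l G2u] : 162%:R <= 100%:R * G2 /\ 100%:R * G2 <= 163%:R :=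
      approx15_bounds (l := 162) (h := 163) aG2 isT isT.
    have [F2l F2u] : 99%:R <= 100%:R * F2 /\ 100%:R * F2 <= 100%:R :=
      approx15_bounds (l := 99) (h := 100) aF2 isT isT.
    lra.
  + have [F1l F1u] : - 7%:R <= 100%:R * F1 /\ 100%:R * F1 <= - 6%:R :=
      approx15_bounds (l := -7) (h := -6) aF1 isT isT.
    have [J1l J1u] : - 100%:R <= 100%:R * J1 /\ 100%:R * J1 <= - 99%:R :=
      approx15_bounds (l := -100) (h := -99) aJ1 isT isT.
    lra.
Qed.

(** Equating the two abscissae cancels [G1] and leaves an equation linear in [G2]; multiplied by
    [r], it involves only [r ^ 2 = 3]. *)
Lemma aligned_apexes (R : realType) (r D1 dx D2 F1 fx F2 G1 G2 H1 J1 : R) :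
    r ^+ 2 = 3%:R -> D1 = r * dx -> F1 = r * fx -> H1 = J1 ->
    H1 - D1 = (G1 - D1) / 2%:R - r * (- (G2 - D2)) / 2%:R ->
    J1 - F1 = (G1 - F1) / 2%:R - r * (G2 - F2) / 2%:R ->
  G2 = (D2 + F2) / 2%:R - (dx - fx) / 2%:R.
Proof.
move=> r2 DE FE HJ HE JE.
have : r * (2%:R * G2 - D2 - F2) + (D1 - F1) = 0 by lra.
move/(congr1 ( *%R r)); rewrite mulr0 DE FE.
have -> : r * (r * (2%:R * G2 - D2 - F2) + (r * dx - r * fx)) =
  r ^+ 2 * (2%:R * G2 - D2 - F2 + (dx - fx)) by ring.
by rewrite r2 => rE; lra.
Qed.

Theorem mainTheorem6 (R : realType) (t T : R) (D E F G H J : R * R)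
    (hsys : harborth_system t T D E F G H J)
    (happ : harborth_approx t T D E F G H J) :
  [/\ algebraicOver (ratr : rat -> R) D.2 /\ has_min_poly D.2 P_yD,
      algebraicOver (ratr : rat -> R) E.2 /\ has_min_poly E.2 P_yE
    & algebraicOver (ratr : rat -> R) F.2 /\ has_min_poly F.2 P_yF].
Proof.
suff [rD rE rF] : [/\ root (zpoly R (zspread coef_yD)) D.2,
    root (zpoly R (zspread coef_yE)) E.2 & root (zpoly R (zspread coef_yF)) F.2].
  have mp (y : R) (P : {poly rat}) s : P = zpoly rat s -> irreducible_poly P ->
      root (zpoly R s) y ->
      algebraicOver (ratr : rat -> R) y /\ has_min_poly y P.
    move=> PE irrP rP; have rP' : root (map_poly ratr P) y by rewrite PE map_zpoly.
    by split=> //; exists P => //; apply: irredp_neq0.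
  split; [apply: mp P_yDE irreducible_yD rD | apply: mp P_yEE irreducible_yE rE |
    exact: mp P_yFE irreducible_yF rF].
case: D E F G H J hsys happ => [D1 D2] [E1 E2] [F1 F2] [G1 G2] [H1 H2] [J1 J2].
move=> [[tT hD1 hD2] [[hE1 hE2 hF hEF] [[hFG hDG hDH hGH] [hFJ hGJ hHJ]]]].
move=> /harborth_approx_signs /= [[crD crE crH crJ] [T1 T2 t0 D20 E20]].
rewrite /sqdist /= in tT hD1 hD2 hE1 hE2 hF hEF hFG hDG hDH hGH hFJ hGJ hHJ.
pose r : R := Num.sqrt 3%:R.
have r2 : r ^+ 2 = 3%:R by rewrite sqr_sqrtr ?ler0n.
have r0 : 0 < r by rewrite sqrtr_gt0 ltr0n.
have rn0 : r != 0 by rewrite gt_eqF.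
(* Seen from [C], the component of [D] along [(-t, T)] is [3/2], and [9 = (3/2)^2 + 3 (3/2)^2]. For
   [E] seen from [B] it is 1, and [4 = 1 + 3]. *)
have [D1E D2E] : D1 - 2%:R * t = 3%:R / 2%:R * r * T - 3%:R / 2%:R * t /\
    D2 = 3%:R / 2%:R * T + 3%:R / 2%:R * r * t.
  apply: unit_frame => //; first by rewrite mulr_gt0 ?divr_gt0 ?ltr0n.
    by rewrite hD2; field.
have [E1E E2E] : E1 - t = 1 * r * T - 1 * t /\ E2 - T = 1 * T + 1 * r * t.
  apply: unit_frame => //; first by rewrite mul1r.
    by rewrite -[RHS]subr0 -hE1; ring.
  by rewrite hE2; ring.
(* Ordinates are negated because DGH and FGJ have opposite orientations. *)
have HE : H1 - D1 = (G1 - D1) / 2%:R - r * (- (G2 - D2)) / 2%:R.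
  apply: (@equilateral_apex _ _ 4%:R _ _ _ (- (H2 - D2)) r2 r0); rewrite ?ltr0n //.
  - by rewrite -hDG; ring.
  - by rewrite -hDH; ring.
  - by rewrite -hGH; ring.
  have -> : (G1 - D1) * - (H2 - D2) - - (G2 - D2) * (H1 - D1) =
    (D1 - G1) * (H2 - D2) + (D2 - G2) * (D1 - H1) by ring.
  exact: crH.
have JE : J1 - F1 = (G1 - F1) / 2%:R - r * (G2 - F2) / 2%:R.
  apply: (@equilateral_apex _ _ 1 _ _ _ (J2 - F2) r2 r0); rewrite ?ltr0n //.
  - by rewrite -hFG; ring.
  - by rewrite -hFJ; ring.
  - by rewrite -hGJ; ring.
  have -> : (G1 - F1) * (J2 - F2) - (G2 - F2) * (J1 - F1) =
    (F1 - G1) * (F2 - J2) + (G2 - F2) * (F1 - J1) by ring.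
  exact: crJ.
(* From now on abscissae are divided by [r], which makes the system rational. *)
pose th := t / r; have tE : t = r * th by rewrite /th; field.
pose dx := D1 / r; have dE : D1 = r * dx by rewrite /dx; field.
pose fx := F1 / r; have fE : F1 = r * fx by rewrite /fx; field.
pose gx := G1 / r; have gE : G1 = r * gx by rewrite /gx; field.
have T2E : T ^+ 2 + 3%:R * th ^+ 2 = 1 by rewrite -r2 -tT tE; ring.
have dxE : dx = th / 2%:R + 3%:R / 2%:R * T.
  by rewrite /dx -[D1](subrK (2%:R * t)) D1E tE; field.
have D2E' : D2 = 3%:R / 2%:R * T + 9%:R / 2%:R * th.
  have -> : D2 = 3%:R / 2%:R * T + 3%:R / 2%:R * r * t by exact: D2E.
  have -> : 3%:R / 2%:R * r * t = 3%:R / 2%:R * r ^+ 2 * th.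
    by rewrite tE; ring.
  by rewrite r2; field.
have exE : E1 = r * T by rewrite -[E1](subrK t) E1E; ring.
have E2E' : E2 = 2%:R * T + 3%:R * th.
  have -> : 3%:R * th = r * t by rewrite tE -r2; ring.
  by rewrite -[E2](subrK T) E2E; ring.
have gyE := aligned_apexes r2 dE fE hHJ HE JE.
have hF' : 3%:R * fx ^+ 2 + F2 ^+ 2 = 1 by rewrite -[RHS]hF fE -r2; ring.
have hEF' : 3%:R * (T - fx) ^+ 2 + (E2 - F2) ^+ 2 = 1.
  by rewrite -[RHS]hEF exE fE -r2; ring.
apply: (@roots_of_rational_system R T th dx D2 E2 fx F2 gx G2) => //.
- by rewrite divr_gt0.
- by rewrite -[RHS]hFG fE gE -r2; ring.
- by rewrite -[RHS]hDG dE gE -r2; ring.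
Qed.
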